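(* Let $T$ be a finite tree. Then $T$ has a difference-1 colouring if and only if its reduced form is (isomorphic to) the path $P_2$ on two vertices.
   Context: A colouring of a graph $G$ is a map $c:E(G)\to\{\text{blue},\text{red}\}$; it is a difference-1 colouring if at every vertex $v$ the number of incident blue edges minus the number of incident red edges equals $1$. A leaf is a vertex of degree $1$. A twig is a configuration of three vertices: a vertex $b$ of degree $3$ (the base) together with two leaves adjacent to $b$. A leaf-twig configuration at a vertex $v$ consists of four vertices distinct from $v$: a leaf $\ell$ and a twig with base $b$ (and its two leaves), where $\ell$ and $b$ are both adjacent to $v$. Removing a leaf-twig configuration means deleting these four vertices and their four incident edges. The reduced form of $G$ is the graph obtained by repeatedly removing leaf-twig configurations until none remain (the paper notes this is determined up to isomorphism). *)

(* Defs.v *)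
From mathcomp Require Import all_boot all_order all_algebra.

Set Implicit Arguments.
Unset Strict Implicit.
Unset Printing Implicit Defensive.

Record sgraph := SGraph {
  vertex :> finType;
  adj : rel vertex;
  adj_sym : symmetric adj;
  adj_irrefl : irreflexive adj }.

Definition edges (G : sgraph) : {set {set G}} :=
  [set [set u.1; u.2] | u : G * G & adj u.1 u.2].

Definition edge (G : sgraph) : finType := {e : {set G} | e \in edges G}.

Definition degree (G : sgraph) (x : G) : nat := #|[set y | adj x y]|.

Definition leaf (G : sgraph) (x : G) : bool := degree x == 1.

Definition connected (G : sgraph) : Prop :=
  forall x y : G, connect (@adj G) x y.

(* The bound on the size is needed because for [ucycle] a single edge,
   traversed back and forth, is a cycle of size 2. *)
Definition acyclic (G : sgraph) : Prop :=
  forall s : seq G, 2 < size s -> ~ ucycle (@adj G) s.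

Definition tree (G : sgraph) : Prop :=
  [/\ 0 < #|G|, connected G & acyclic G].

Definition isomorphic (G H : sgraph) : Prop :=
  exists2 f : G -> H, bijective f & forall x y, adj (f x) (f y) = adj x y.

Definition path_adj (n : nat) : rel 'I_n :=
  fun i j => (i.+1 == j) || (j.+1 == i).

Lemma path_adj_sym n : symmetric (@path_adj n).
Proof. by move=> i j; rewrite /path_adj orbC. Qed.

Lemma path_adj_irrefl n : irreflexive (@path_adj n).
Proof. by move=> i; rewrite /path_adj orbb gtn_eqF. Qed.

(* The path on [n] vertices, i.e. with [n.-1] edges. *)
Definition path_graph (n : nat) : sgraph :=
  SGraph (@path_adj_sym n) (@path_adj_irrefl n).

Definition colour := bool.
Definition blue : colour := true.
Definition red : colour := false.

Definition colour_degree (G : sgraph) (c : edge G -> colour) (k : colour)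
    (v : G) : nat :=
  #|[set e : edge G | (v \in val e) && (c e == k)]|.

Definition difference1 (G : sgraph) (c : edge G -> colour) : Prop :=
  forall v : G,
    ((colour_degree c blue v)%:Z - (colour_degree c red v)%:Z = 1)%R.

Definition twig (G : sgraph) (b p q : G) : bool :=
  [&& degree b == 3, leaf p, leaf q, p != q, adj b p & adj b q].

Definition leaf_twig (G : sgraph) (v l b p q : G) : bool :=
  [&& uniq [:: v; l; b; p; q], leaf l, twig b p q, adj v l & adj v b].

Section Induced.
Variables (G : sgraph) (A : {set G}).

Definition induced_adj : rel {x : G | x \in A} :=
  fun x y => adj (val x) (val y).

Lemma induced_adj_sym : symmetric induced_adj.
Proof. by move=> x y; apply: adj_sym. Qed.

Lemma induced_adj_irrefl : irreflexive induced_adj.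
Proof. by move=> x; apply: adj_irrefl. Qed.

Definition induced : sgraph := SGraph induced_adj_sym induced_adj_irrefl.
End Induced.

(* The only edges meeting [l], [b], [p], [q] are [vl], [vb], [bp], [bq], so
   deleting the configuration leaves the subgraph induced on the remaining
   vertices. *)
Definition remove_leaf_twig (G : sgraph) (l b p q : G) : sgraph :=
  induced (~: [set l; b; p; q]).

Inductive reduces : sgraph -> sgraph -> Prop :=
| reduces_refl (G : sgraph) : reduces G G
| reduces_step (G H : sgraph) (v l b p q : G) :
    leaf_twig v l b p q -> reduces (remove_leaf_twig l b p q) H -> reduces G H.

(* A reduced form depends on the removals made; it is unique only up to
   isomorphism, hence a relation and not a function. *)
Definition reduced_form (G R : sgraph) : Prop :=
  reduces G R /\ forall v l b p q : R, ~~ leaf_twig v l b p q.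

Lemma card_remove_leaf_twig (G : sgraph) (l b p q : G) :
  #|remove_leaf_twig l b p q| < #|G|.
Proof.
rewrite card_sig; apply: proper_card; apply/properP; split.
  exact/subsetP.
by exists l; rewrite // !inE eqxx.
Qed.

Lemma reduced_form_exists (G : sgraph) : exists R, reduced_form G R.
Proof.
have [n] := ubnP #|G|; elim: n G => // n IHn G leGn.
pose P (u : G * G * G * G * G) :=
  leaf_twig u.1.1.1.1 u.1.1.1.2 u.1.1.2 u.1.2 u.2.
have [[[[[v l] b] p] q] /= Pu|noP] := pickP P.
  have [|R [redR fixR]] := IHn (remove_leaf_twig l b p q).
    exact: leq_trans (card_remove_leaf_twig l b p q) leGn.
  by exists R; split=> //; apply: reduces_step Pu redR.
exists G; split; first exact: reduces_refl.
by move=> v l b p q; have /= := noP (v, l, b, p, q); rewrite /P /= => ->.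
Qed.

(* Main.v *)
Require Import Defs.
From mathcomp Require Import all_boot all_order all_algebra.
From mathcomp Require Import zify.

(** Work with symmetric relations [c] ("[xy] is blue") and the integer
    [balance c v] of blue minus red edges at [v], which must equal 1. Edges at
    leaves are blue, so in a leaf-twig configuration at [v] with leaf [l] and
    base [b] the edge [vl] is blue and [vb] is red; these cancel at [v], and
    removing or restoring the configuration does not affect the existence of a
    colouring. Conversely, let [x, y, z, ...] be a longest path of a coloured
    tree. All neighbours of [y] but [z] are leaves, and the balance at [y] makes
    [yz] red and [y] the base of a twig. Then [z] has two blue edges, one of
    which leaves the path; its end is a leaf, since otherwise it would be the
    second vertex of another longest path and its edge to [z] would be red. So
    there is a leaf-twig configuration at [z], unless the path has only two
    vertices. *)

Set Implicit Arguments.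
Unset Strict Implicit.
Unset Printing Implicit Defensive.

Import GRing.Theory.

(** * Colourings as symmetric relations *)

Definition balance (G : sgraph) (c : rel G) (v : G) : int :=
  (\sum_(y | adj v y) (if c v y then 1 else -1))%R.

Definition balanced (G : sgraph) : Prop :=
  exists2 c : rel G, symmetric c & forall v, balance c v = 1%R.

Lemma set2_injr (T : finType) (v : T) : injective (fun y => [set v; y]).
Proof.
move=> y z /setP eq_vy_vz.
have := eq_vy_vz z; have := eq_vy_vz y; rewrite !inE !eqxx !orbT.
by move=> /esym/predU1P[->|/eqP//] /predU1P[->|/eqP->].
Qed.

Section Balance.
Variables (G : sgraph) (c : rel G).

Lemma adj_edges (x y : G) : ([set x; y] \in edges G) = adj x y.
Proof.
apply/imsetP/idP => [[[u w] /=]|adj_xy]; last first.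
  by exists (x, y); rewrite ?inE.
rewrite inE /= => adj_uw eq_xy_uw.
have: u \in [set x; y] by rewrite eq_xy_uw !inE eqxx.
rewrite !inE => /orP[] /eqP eq_u; subst u.
  by rewrite (set2_injr eq_xy_uw).
by rewrite setUC in eq_xy_uw; rewrite (set2_injr eq_xy_uw) adj_sym.
Qed.

Lemma balanceE v :
  balance c v = (#|[set y | adj v y & c v y]|%:Z
                 - #|[set y | adj v y & ~~ c v y]|%:Z)%R.
Proof.
rewrite /balance (bigID (c v)) /=; congr (_ + _)%R.
  rewrite (eq_bigr (fun=> 1%R)) => [|y /andP[_ ->]//].
  rewrite sumr_const -natz; congr (_%:R)%R.
  by apply: eq_card => y; rewrite !inE.
rewrite (eq_bigr (fun=> -1)%R) => [|y /andP[_ /negPf->]//].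
rewrite sumr_const -natz mulNrn; congr (- _%:R)%R.
by apply: eq_card => y; rewrite !inE.
Qed.

(** The map sending [y] to [[set v; y]] is a bijection from the neighbours of [v] onto the edges at
    [v]. Since [x] and [y] may be exchanged in the hypothesis, [c] agrees with [d] whichever end of
    an edge comes first. *)
Lemma colour_degreeE (d : edge G -> colour) k v :
    (forall e x y, val e = [set x; y] -> d e = c x y) ->
  colour_degree d k v = #|[set y | adj v y & c v y == k]|.
Proof.
move=> d_c; rewrite -[RHS](card_imset _ (@set2_injr G v)).
rewrite /colour_degree -[LHS](card_imset _ val_inj).
apply: eq_card => A; apply/imsetP/imsetP => [[e]|[y]].
  rewrite inE => /andP[ve /eqP de] ->.
  have /imsetP[[x y]] := valP e; rewrite inE /= => adj_xy.
  rewrite -[sval e]/(val e) => eq_e.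
  move: ve; rewrite eq_e !inE => /orP[] /eqP eq_v; subst v.
    by exists y; rewrite // inE adj_xy -(d_c e) // de eqxx.
  have eq_e' : val e = [set y; x] by rewrite eq_e setUC.
  by exists x; rewrite 1?setUC // inE adj_sym adj_xy -(d_c e) // de eqxx.
rewrite inE -adj_edges => /andP[vyG /eqP cvy] ->.
exists (Sub [set v; y] vyG); rewrite ?SubK // inE SubK !inE eqxx /=.
by rewrite (@d_c _ v y) ?SubK // cvy.
Qed.

Lemma difference1E (d : edge G -> colour) :
    (forall e x y, val e = [set x; y] -> d e = c x y) ->
  difference1 d <-> forall v, balance c v = 1%R.
Proof.
move=> d_c; have eq_d v : balance c v =
    ((colour_degree d blue v)%:Z - (colour_degree d red v)%:Z)%R.
  rewrite balanceE !colour_degreeE //; congr (Posz _ - Posz _)%R.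
    by apply: eq_card => y; rewrite !inE; case: c.
  by apply: eq_card => y; rewrite !inE; case: c.
by split=> bal v; move: (bal v); rewrite eq_d.
Qed.

End Balance.

Lemma difference1_balanced (G : sgraph) :
  (exists c : edge G -> colour, difference1 c) <-> balanced G.
Proof.
split=> [[d dP]|[c c_sym cP]].
  (* The default value is taken only on non-adjacent pairs, which [balance] never sees. *)
  pose c (x y : G) := if insub [set x; y] is Some e then d e else true.
  exists c => [x y|]; first by rewrite /c setUC.
  apply/(difference1E (d := d)) => // e x y eq_e.
  by rewrite /c -eq_e valK.
(* The ends of [e] come in no order; symmetry of [c] makes the choice immaterial. *)
pose d (e : edge G) := [exists x, exists y, (val e == [set x; y]) && c x y].
exists d; apply/(difference1E (c := c)) => // e x y eq_e.
apply/existsP/idP => [[u /existsP[w /andP[/eqP]]]|cxy]; last first.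
  by exists x; apply/existsP; exists y; rewrite eq_e eqxx.
rewrite eq_e => eq_xy_uw.
have: u \in [set x; y] by rewrite eq_xy_uw !inE eqxx.
rewrite !inE => /orP[] /eqP eq_u; subst u.
  by rewrite (set2_injr eq_xy_uw).
by rewrite setUC in eq_xy_uw; rewrite (set2_injr eq_xy_uw) c_sym.
Qed.

(** * Leaves and the colour of their edges *)

Lemma leaf_adj (G : sgraph) (x y z : G) :
  leaf x -> adj x y -> adj x z = (z == y).
Proof.
move=> /cards1P[w /setP Nx] adj_xy.
have := Nx y; have := Nx z; rewrite !inE adj_xy => -> /esym/eqP->.
by [].
Qed.

Lemma leaf_balance (G : sgraph) (c : rel G) (x y : G) :
  leaf x -> adj x y -> balance c x = (if c x y then 1 else -1)%R.
Proof.
move=> leaf_x adj_xy; rewrite /balance.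
under eq_bigl do rewrite (leaf_adj _ leaf_x adj_xy).
by rewrite big_pred1_eq.
Qed.

Lemma leaf_blue (G : sgraph) (c : rel G) (x y : G) :
  leaf x -> adj x y -> balance c x = 1%R -> c x y.
Proof.
by move=> leaf_x adj_xy; rewrite (leaf_balance c leaf_x adj_xy); case: c.
Qed.

(** * Removal of a leaf-twig configuration *)

Section RemoveLeafTwig.
Variables (G : sgraph) (v l b p q : G).
Hypothesis lt_v : leaf_twig v l b p q.
Let D := [set l; b; p; q].
Let H := remove_leaf_twig l b p q.

Let uniq_vlbpq : uniq [:: v; l; b; p; q].
Proof. by case/and4P: lt_v. Qed.

Let leaf_l : leaf l. Proof. by case/and4P: lt_v. Qed.
Let leaf_p : leaf p. Proof. by case/and4P: lt_v => _ _ /and5P[]. Qed.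
Let leaf_q : leaf q. Proof. by case/and4P: lt_v => _ _ /and5P[]. Qed.
Let adj_lv : adj l v.
Proof. by rewrite adj_sym; case/and4P: lt_v => _ _ _ /andP[]. Qed.
Let adj_pb : adj p b.
Proof. by rewrite adj_sym; case/and4P: lt_v => _ _ /and5P[_ _ _ _ /andP[]]. Qed.
Let adj_qb : adj q b.
Proof. by rewrite adj_sym; case/and4P: lt_v => _ _ /and5P[_ _ _ _ /andP[]]. Qed.

(** The three listed vertices are distinct neighbours of [b], which has degree 3, so there are no
    others. *)
Let adj_b z : adj b z = (z \in [:: v; p; q]).
Proof.
have [_ _ /and5P[/eqP deg_b _ _ neq_pq /andP[adj_bp adj_bq]]] := and4P lt_v.
move=> /andP[_ adj_vb]; have sub_b : [set v; p; q] \subset [set y | adj b y].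
  apply/subsetP=> y; rewrite !inE => /orP[/orP[]|] /eqP-> //.
  by rewrite adj_sym.
have card_vpq : #|[set v; p; q]| = 3.
  move: uniq_vlbpq; rewrite /= !inE !negb_or.
  move=> /and5P[/and4P[_ _ vp vq] _ _ _ _].
  by rewrite -setUA cardsU1 cards2 !inE negb_or vp vq neq_pq.
have /eqP/setP/(_ z) : [set v; p; q] == [set y | adj b y].
  by rewrite eqEcard sub_b card_vpq; apply: eq_leq.
by rewrite !inE orbA => ->.
Qed.

Let vND : v \in ~: D.
Proof.
move: uniq_vlbpq => /andP[+ _]; rewrite !inE !negb_or => /and4P[-> -> -> ->].
by [].
Qed.

(** All neighbours of [l], [b], [p] and [q] are known, and the configuration hangs from the rest of
    the graph at [v] alone. *)
Let adj_D x y : x \in D -> adj x y -> y = v \/ y \in D.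
Proof.
rewrite !inE => /orP[/orP[/orP[]|]|] /eqP->.
- by rewrite (leaf_adj _ leaf_l adj_lv) => /eqP; left.
- by rewrite adj_b !inE => /or3P[] /eqP->; rewrite ?eqxx ?orbT; auto.
- by rewrite (leaf_adj _ leaf_p adj_pb) => /eqP->; rewrite eqxx !orbT; right.
- by rewrite (leaf_adj _ leaf_q adj_qb) => /eqP->; rewrite eqxx !orbT; right.
Qed.

Lemma remove_leaf_twig_connected : connected G -> connected H.
Proof.
(* The retraction [r] collapses [D] to [v]. It sends each edge of [G] to an edge of [H] or to a
   single vertex, so walks in [G] project to walks in [H]. *)
move=> connG x y; pose v' : H := Sub v vND; pose r (u : G) : H := insubd v' u.
have rE u : u \in ~: D -> val (r u) = u.
  by move=> uND; rewrite /r val_insubd uND.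
have rD u : u \in D -> r u = v'.
  by move=> uD; rewrite /r /insubd insubF // inE uD.
have rv : r v = v' by apply: val_inj; rewrite rE.
have r_adj u w : adj u w -> connect (@adj H) (r u) (r w).
  move=> adj_uw; have [uD|uND] := boolP (u \in D).
    by have [->|wD] := adj_D uD adj_uw; rewrite rD // ?rv // rD.
  have [wD|wND] := boolP (w \in D).
    have [eq_uv|uD] := adj_D wD (etrans (adj_sym _ _) adj_uw).
      by rewrite eq_uv rv rD.
    by rewrite uD in uND.
  apply: connect1; rewrite /= /induced_adj.
  by rewrite !rE ?in_setC.
have rK (u : H) : r (val u) = u by rewrite /r valKd.
rewrite -(rK x) -(rK y); have /connectP[s + ->] := connG (val x) (val y).
elim: s (val x) => //= z s IHs u /andP[adj_uz path_s].
exact: connect_trans (r_adj _ _ adj_uz) (IHs z path_s).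
Qed.

Lemma remove_leaf_twig_acyclic : acyclic G -> acyclic H.
Proof.
move=> acG s s_gt2 /andP[cyc_s uniq_s].
apply: (acG (map val s)); first by rewrite size_map.
by rewrite /ucycle (map_inj_uniq val_inj) uniq_s andbT cycle_map.
Qed.

Lemma remove_leaf_twig_tree : tree G -> tree H.
Proof.
case=> _ connG acG; split; last exact: remove_leaf_twig_acyclic.
  by apply/card_gt0P; exists (Sub v vND).
exact: remove_leaf_twig_connected.
Qed.

(** Only [v] loses neighbours, namely [l] and [b], whose contributions 1 and -1 cancel. As [c'] is
    any relation agreeing with [c], this serves both to restrict a colouring and to extend one. *)
Let balance_remove (c : rel G) (c' : rel H) (u : H) :
    (forall x y : H, c' x y = c (val x) (val y)) -> c v l -> ~~ c v b ->
  balance c (val u) = balance c' u.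
Proof.
move=> c'E cvl cvb; rewrite /balance (bigID (mem D)) /=.
set S := (X in (X + _)%R); have -> : S = 0%R.
  rewrite {}/S; have [eq_uv|neq_uv] := eqVneq (val u) v; last first.
    rewrite big_pred0 // => y; apply/andP=> -[adj_uy yD].
    have [] := adj_D yD (etrans (adj_sym _ _) adj_uy); first exact/eqP.
    by apply/negP; have := valP u; rewrite inE.
  rewrite eq_uv (eq_bigl [in [:: l; b]]) => [|y].
    rewrite -big_uniq ?big_cons ?big_nil ?cvl ?(negPf cvb) //=.
    by move: uniq_vlbpq; rewrite /= !inE !negb_or => /and3P[_ /and3P[-> _ _] _].
  move: uniq_vlbpq; rewrite /= !inE !negb_or.
  move=> /and5P[/and4P[_ vb _ _] _ _ _ _].
  apply/andP/idP => [[adj_vy]|]; last first.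
    by case/orP=> /eqP->; rewrite eqxx ?orbT adj_sym // adj_b !inE eqxx.
  rewrite adj_sym in adj_vy.
  case/orP=> [/orP[//|]|] /eqP eq_y; move: adj_vy; rewrite eq_y.
    by rewrite (leaf_adj _ leaf_p adj_pb) (negPf vb).
  by rewrite (leaf_adj _ leaf_q adj_qb) (negPf vb).
rewrite add0r (eq_bigl (fun y => (y \in ~: D) && adj (val u) y)) => [|y].
  by rewrite big_sub_cond; apply: eq_bigr => y _; rewrite c'E.
by rewrite andbC !inE.
Qed.

Lemma remove_leaf_twig_balanced : balanced G <-> balanced H.
Proof.
split=> [[c c_sym cP]|[c' c'_sym c'P]].
  have cvl : c v l by rewrite c_sym; apply: leaf_blue leaf_l adj_lv (cP l).
  (* At [b] the edges to the leaves [p] and [q] are blue, so balance 1 forces the third edge to be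
     red. *)
  have cvb : ~~ c v b.
    have := cP b; rewrite /balance (eq_bigl _ _ adj_b) -big_uniq /=; last first.
      move: uniq_vlbpq; rewrite /= !inE !negb_or.
      by move=> /and5P[/and4P[_ _ -> ->] _ _ -> _].
    rewrite !big_cons big_nil [c v b]c_sym [c b p]c_sym [c b q]c_sym.
    rewrite (leaf_blue leaf_p adj_pb (cP p)) (leaf_blue leaf_q adj_qb (cP q)).
    by case: (c b v).
  exists (fun x y : H => c (val x) (val y)) => [x y|u]; first exact: c_sym.
  by rewrite -(@balance_remove c) // cP.
(* Every edge meeting [D] becomes blue except [vb]; [insub] fails exactly on [D]. *)
pose c x y := match insub x : option H, insub y : option H with
  | Some x', Some y' => c' x' y'
  | _, _ => ~~ ((x == b) && (y == v) || (x == v) && (y == b))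
  end.
have c_sym : symmetric c.
  move=> x y; rewrite /c; case: insub => [x'|]; case: insub => [y'|] //;
    by rewrite orbC andbC [(x == b) && _]andbC.
have insubH x : x \in D -> insub x = None :> option H.
  by move=> xD; rewrite insubF // in_setC xD.
have [lD bD pD qD] : [/\ l \in D, b \in D, p \in D & q \in D].
  by rewrite /D !inE !eqxx !orbT.
have c'E (x y : H) : c' x y = c (val x) (val y) by rewrite /c !valK.
have uniqG := uniq_vlbpq; rewrite /= !inE !negb_or in uniqG.
have [/and4P[vl vb vp vq] /and3P[lb lp lq] /andP[bp bq] pq _] := and5P uniqG.
have clv : c l v by rewrite /c insubH // (negPf lb) [l == v]eq_sym (negPf vl).
have cbv : c b v = false by rewrite /c insubH // !eqxx.
have cpb : c p b.
  by rewrite /c insubH // [p == b]eq_sym (negPf bp) [p == v]eq_sym (negPf vp).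
have cqb : c q b.
  by rewrite /c insubH // [q == b]eq_sym (negPf bq) [q == v]eq_sym (negPf vq).
exists c => // x; have [xD|xND] := boolP (x \in D); last first.
  have xH : x \in ~: D by rewrite in_setC.
  rewrite -[x]/(val (Sub x xH : H)) (@balance_remove c c') ?c'P //.
    by rewrite c_sym.
  by rewrite c_sym cbv.
move: xD; rewrite /D !inE => /orP[/orP[/orP[]|]|] /eqP->.
- by rewrite (leaf_balance c leaf_l adj_lv) clv.
- rewrite /balance (eq_bigl _ _ adj_b) -big_uniq /= ?inE ?negb_or ?vp ?vq ?pq //.
  by rewrite !big_cons big_nil cbv [c b p]c_sym [c b q]c_sym cpb cqb.
- by rewrite (leaf_balance c leaf_p adj_pb) cpb.
- by rewrite (leaf_balance c leaf_q adj_qb) cqb.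
Qed.

End RemoveLeafTwig.

(** * Transfer along reductions, and the path on two vertices *)

Lemma reduces_tree (G H : sgraph) : reduces G H -> tree G -> tree H.
Proof.
elim=> [//|{}G {}H v l b p q lt_v _ IH treeG].
exact/IH/(remove_leaf_twig_tree lt_v).
Qed.

Lemma reduces_balanced (G H : sgraph) :
  reduces G H -> balanced G <-> balanced H.
Proof.
elim=> [//|{}G {}H v l b p q lt_v _ <-].
exact: remove_leaf_twig_balanced lt_v.
Qed.

Lemma path_graph2_balanced (G : sgraph) :
  isomorphic G (path_graph 2) -> balanced G.
Proof.
case=> f f_bij f_adj; exists (fun _ _ => true) => // v; rewrite /balance.
transitivity (\sum_(i : 'I_2 | path_adj (f v) i) 1 : int)%R.
  rewrite (reindex f) /=; last exact: onW_bij.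
  by apply: eq_bigl => y; rewrite -f_adj.
rewrite big_mkcond !big_ord_recl big_ord0 /path_adj.
by case: (f v) => -[|[|]].
Qed.

(** * Ends of longest paths in acyclic graphs *)

Section Longest.
Variable G : sgraph.

Definition longest (s : seq G) : Prop :=
  [/\ sorted (@adj G) s, uniq s
    & forall t : seq G, sorted (@adj G) t -> uniq t -> size t <= size s].

Lemma longest_exists : exists s, longest s.
Proof.
pose P n := [exists t : n.-tuple G, sorted (@adj G) t && uniq t].
have exP : exists n, P n by exists 0; apply/existsP; exists [tuple].
have ubP n : P n -> n <= #|G|.
  move=> /existsP[t /andP[_ /card_uniqP]].
  by rewrite size_tuple => <-; apply: max_card.
case: (ex_maxnP exP ubP) => n /existsP[t /andP[sorted_t uniq_t]] maxP.
exists t; split=> // u sorted_u uniq_u; rewrite size_tuple; apply: maxP.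
by apply/existsP; exists (in_tuple u); rewrite sorted_u.
Qed.

Lemma adj_neq (x y : G) : adj x y -> x != y.
Proof. by apply: contraTneq => ->; rewrite adj_irrefl. Qed.

(** Otherwise [y] could be prepended, giving a longer path. *)
Lemma longest_cons (x y : G) s : longest (x :: s) -> adj y x -> y \in s.
Proof.
move=> [sorted_s uniq_s max_s] adj_yx.
have := max_s (y :: x :: s); rewrite [size (y :: _)]/= ltnn /=.
rewrite adj_yx in_cons negb_or (adj_neq adj_yx) /= in sorted_s uniq_s *.
by rewrite sorted_s uniq_s andbT; have [//|_ /(_ isT isT)] := boolP (y \in s).
Qed.

Hypothesis acG : acyclic G.

(** A chord from [x] to [z] would close the initial segment ending at [z] into a cycle on at least
    three vertices. *)
Lemma acyclic_chord (x y z : G) s :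
  path (@adj G) x (y :: s) -> uniq [:: x, y & s] -> adj x z -> z \notin s.
Proof.
move=> path_s uniq_s adj_xz; apply/negP => /splitPr zs.
case: zs path_s uniq_s => s1 s2 path_s uniq_s.
apply: (acG (s := [:: x, y & rcons s1 z])); first by rewrite /= size_rcons.
rewrite -cat_rcons -!cat_cons in path_s uniq_s.
move: uniq_s path_s; rewrite /ucycle cat_uniq => /and3P[-> _ _].
rewrite cat_path andbT => /andP[path_s _].
by rewrite /cycle rcons_path path_s /= last_rcons adj_sym.
Qed.

(** Maximality puts [z] on the path, and acyclicity excludes everything beyond [y]. *)
Lemma longest_leaf (x y z : G) s :
  longest [:: x, y & s] -> adj x z -> z = y.
Proof.
move=> long adj_xz; have := longest_cons long (etrans (adj_sym _ _) adj_xz).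
case: long => path_s uniq_s _; rewrite inE => /predU1P[//|].
by rewrite (negPf (acyclic_chord path_s uniq_s adj_xz)).
Qed.

Lemma longest_leafP (x y : G) s : longest [:: x, y & s] -> leaf x.
Proof.
move=> long; apply/cards1P; exists y; apply/setP=> z; rewrite !inE.
apply/idP/eqP => [|->]; first exact: longest_leaf long.
by case: long => /andP[].
Qed.

(** By acyclicity the only neighbour of [y] on the rest of the path is [z]. Hence each other
    neighbour of [y] ends a longest path, and is a leaf. *)
Lemma longest_swap (x x' y z : G) s :
    longest [:: x, y, z & s] -> adj x' y -> x' != z ->
  longest [:: x', y, z & s].
Proof.
move=> [/andP[_ path_s]]; rewrite cons_uniq => /andP[_ uniq_s] max_s.
move=> adj_x'y neq_x'z.
split=> [||//]; first by rewrite /= adj_x'y.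
rewrite cons_uniq uniq_s andbT !in_cons !negb_or neq_x'z (adj_neq adj_x'y).
by apply: (acyclic_chord path_s uniq_s); rewrite adj_sym.
Qed.

Variable c : rel G.
Hypothesis c_sym : symmetric c.
Hypothesis c_balanced : forall v, balance c v = 1%R.

Lemma longest_twig (x y z : G) s : longest [:: x, y, z & s] ->
  ~~ c y z /\ exists p q, [/\ twig y p q, p \notin z :: s & q \notin z :: s].
Proof.
move=> long; have [/= /and3P[adj_xy adj_yz _] uniq_s _] := long.
have longN u : adj y u -> u != z -> longest [:: u, y, z & s].
  by rewrite adj_sym; apply: longest_swap long.
set A := [set u | adj y u & u != z].
have := c_balanced y; rewrite /balance (bigD1 z adj_yz) /=.
rewrite (eq_bigr (fun=> 1%R)) => [|u /andP[adj_yu neq_uz]]; last first.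
  have leaf_u := longest_leafP (longN _ adj_yu neq_uz).
  rewrite adj_sym in adj_yu.
  by rewrite c_sym (leaf_blue leaf_u adj_yu (c_balanced u)).
rewrite sumr_const -(cardsE (fun u => adj y u && (u != z))) -/A.
have A_gt0 : 0 < #|A|.
  apply/card_gt0P; exists x; rewrite !inE adj_sym adj_xy /=.
  by move: uniq_s; rewrite /= !inE !negb_or => /andP[/and3P[]].
(* The balance at [y] is the number of elements of [A] plus or minus 1. As [A] contains [x], the
   sign is negative and [A] has two elements. *)
have [_|cyz cardA] := boolP (c y z); first by rewrite natz; lia.
have card2 : #|A| == 2 by rewrite natz in cardA; lia.
split=> //; have /cards2P[p [q [neq_pq eqA]]] := card2; exists p, q.
have pA : p \in A by rewrite eqA !inE eqxx.
have qA : q \in A by rewrite eqA !inE eqxx orbT.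
move: pA qA; rewrite !inE => /andP[adj_yp neq_pz] /andP[adj_yq neq_qz].
have longp := longN _ adj_yp neq_pz; have longq := longN _ adj_yq neq_qz.
split; last 2 first.
- by case: longp => _ /andP[]; rewrite in_cons negb_or => /andP[].
- by case: longq => _ /andP[]; rewrite in_cons negb_or => /andP[].
rewrite /twig (longest_leafP longp) (longest_leafP longq) neq_pq adj_yp adj_yq.
rewrite !andbT /degree (cardsD1 z) inE adj_yz; apply/eqP; congr (_.+1).
by rewrite -(eqP card2); apply: eq_card => u; rewrite !inE andbC.
Qed.

End Longest.

(** * Irreducible coloured trees and the equivalence *)

Lemma irreducible_tree_balanced (G : sgraph) :
    tree G -> balanced G -> (forall v l b p q : G, ~~ leaf_twig v l b p q) ->
  isomorphic G (path_graph 2).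
Proof.
move=> [/card_gt0P[x0 _] connG acG] [c c_sym cP] irrG.
have [s long] := longest_exists G.
have blue_red v : #|[set y | adj v y & c v y]|
                  = #|[set y | adj v y & ~~ c v y]|.+1.
  by have := cP v; rewrite balanceE; lia.
(* An edge exists, so a longest path has at least two vertices. *)
have [x1 adj_x01] : exists y, adj x0 y.
  have /card_gt0P[y] : 0 < #|[set y | adj x0 y & c x0 y]| by rewrite blue_red.
  by rewrite inE => /andP[adj_y _]; exists y.
case: s long => [|x [|y [|z s]]] long.
- by have [_ _ /(_ [:: x0] isT isT)] := long.
- have [_ _ /(_ [:: x0; x1])] := long.
  by rewrite /= adj_x01 inE (adj_neq adj_x01) => /(_ isT isT).
- have [/= /andP[adj_xy _] _ max_s] := long.
  (* The reversed path is longest too, so [x] and [y] are each other's only neighbours and no walk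
     leaves them. *)
  have long' : longest [:: y; x].
    split=> //=; first by rewrite adj_sym adj_xy.
    by rewrite inE eq_sym (adj_neq adj_xy).
  have last_xy t v : v = x \/ v = y ->
      path (@adj G) v t -> last v t = x \/ last v t = y.
    elim: t v => //= w t IHt v eq_v /andP[adj_vw]; apply: IHt.
    case: eq_v adj_vw => -> adj_w.
      by right; exact: (longest_leaf acG long adj_w).
    by left; exact: (longest_leaf acG long' adj_w).
  have xy u : u = x \/ u = y.
    by have /connectP[t path_t ->] := connG x u; apply: last_xy path_t; left.
  have neq_yx : y != x by rewrite eq_sym (adj_neq adj_xy).
  exists (fun u => if u == x then ord0 else ord_max : 'I_2).
    exists (fun i : 'I_2 => if i == ord0 then x else y) => [u|i].
      by case: (xy u) => ->; rewrite ?eqxx ?(negPf neq_yx).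
    case: i => -[|[|//]] ltn; rewrite /= ?eqxx ?(negPf neq_yx);
      exact: val_inj.
  move=> u w; case: (xy u) (xy w) => -> [] ->;
    by rewrite ?eqxx ?(negPf neq_yx) /= ?adj_irrefl ?adj_xy // adj_sym adj_xy.
have [/negP cyz [p [q [tw_y pNs qNs]]]] := longest_twig acG c_sym cP long.
have [/= /and3P[adj_xy adj_yz path_s] /= /and3P[_ yNs uniq_s] max_s] := long.
(* Since [zy] is red, [z] has two blue edges. Acyclicity allows only one of them to lead into [s],
   to its first vertex. *)
have [l [adj_zl czl lNs]] : exists l, [/\ adj z l, c z l & l \notin s].
  have: 1 < #|[set u | adj z u & c z u]|.
    rewrite blue_red ltnS; apply/card_gt0P; exists y.
    by rewrite inE adj_sym adj_yz c_sym; apply/negP.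
  case/card_gt1P=> u [w []]; rewrite !inE => /andP[adj_zu czu] /andP[adj_zw czw].
  move=> neq_uw; have [us|uNs] := boolP (u \in s); last by exists u.
  exists w; split=> //; apply/negP=> ws.
  case: s path_s uniq_s us ws {long max_s yNs pNs qNs} => // t s path_s uniq_s.
  have /negPf chord_u := acyclic_chord acG path_s uniq_s adj_zu.
  have /negPf chord_w := acyclic_chord acG path_s uniq_s adj_zw.
  rewrite !inE chord_u chord_w !orbF => /eqP eq_u /eqP eq_w.
  by rewrite eq_u eq_w eqxx in neq_uw.
have path_l : path (@adj G) l (z :: s) by rewrite /= adj_sym adj_zl.
have uniq_l : uniq [:: l, z & s].
  by rewrite /= inE negb_or eq_sym (adj_neq adj_zl) lNs.
have leaf_l : leaf l.
  apply/cards1P; exists z; apply/setP=> w; rewrite !inE.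
  apply/idP/eqP => [adj_lw|->]; last by rewrite adj_sym.
  have [//|neq_wz] := eqVneq w z.
  (* Another neighbour [w] of [l] would give a path as long as the original with [l] in second
     place, making [lz] red. *)
  have long_w : longest [:: w, l, z & s].
    split=> //; first by rewrite /= adj_sym adj_lw.
    rewrite cons_uniq uniq_l andbT !in_cons !negb_or neq_wz.
    by rewrite eq_sym (adj_neq adj_lw) (acyclic_chord acG path_l uniq_l adj_lw).
  have [/negP[]] := longest_twig acG c_sym cP long_w.
  by rewrite c_sym.
have [_ leaf_p leaf_q neq_pq /andP[adj_yp adj_yq]] := and5P tw_y.
have /negP[] := irrG z l y p q.
rewrite /leaf_twig leaf_l tw_y adj_zl adj_sym adj_yz /= !andbT !inE !negb_or.
rewrite neq_pq (adj_neq adj_zl) (adj_neq adj_yp) (adj_neq adj_yq).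
rewrite [z == y]eq_sym (adj_neq adj_yz).
rewrite !inE !negb_or in pNs qNs; have [/andP[pz _] /andP[qz _]] := (pNs, qNs).
rewrite ![z == _]eq_sym pz qz /= andbT.
(* The only neighbour of a leaf of the twig is [y], whereas [l] is adjacent to [z]. *)
have leafN u : leaf u -> adj y u -> l != u.
  move=> leaf_u adj_yu; apply: contraTneq adj_zl => ->.
  rewrite adj_sym (leaf_adj _ leaf_u (etrans (adj_sym _ _) adj_yu)).
  by rewrite eq_sym (adj_neq adj_yz).
rewrite (leafN _ leaf_p adj_yp) (leafN _ leaf_q adj_yq) !andbT.
(* Here [l] differs from [y] because [zl] is blue and [zy] is red. *)
by apply: contraTneq czl => ->; rewrite c_sym; apply/negP.
Qed.

Theorem mainTheorem3 (T : sgraph) (hT : tree T) (R : sgraph)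
    (hR : reduced_form T R) :
  (exists c : edge T -> colour, difference1 c) <->
  isomorphic R (path_graph 2).
Proof.
have [redR irrR] := hR.
rewrite difference1_balanced (reduces_balanced redR).
split; last exact: path_graph2_balanced.
move=> balR; apply: irreducible_tree_balanced => //.
exact: reduces_tree redR hT.
Qed.
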